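(* Let $n=2$ and $0<q<1$. For $\alpha=(\alpha_1,\alpha_2)\in\mathbb{Z}_{\ge0}^2$ and $0<\mu<1$, let $$X_\alpha(\mu)=g_\alpha(\mu)Z_\alpha(\mu),\qquad Z_\alpha(\mu)=\frac{(\mathbf{b}_+)_\infty}{(\mu^{-1}\mathbf{b}_+)_\infty}\,\mathbf{k}^{\alpha_2}\,\mathbf{b}_-^{\alpha_1}.$$ Then for all $\lambda,\mu\in(0,1)$ and all $\alpha,\beta,\gamma\in\mathbb{Z}_{\ge0}^2$ these operators satisfy the Zamolodchikov–Faddeev algebra $$X_\alpha(\mu)X_\beta(\lambda)=\sum_{\gamma',\delta'\in\mathbb{Z}^2_{\ge0}}\mathscr{S}(\lambda,\mu)^{\beta,\alpha}_{\gamma',\delta'}\,X_{\gamma'}(\lambda)X_{\delta'}(\mu)$$ and the auxiliary condition (with $X_0(\lambda)$ invertible) $$X_{\beta}(\mu)X_0(\lambda)^{-1}X_\gamma(\lambda)=q^{\beta_1\gamma_2}\,\frac{g_\beta(\mu)\,g_\gamma(\lambda)}{g_{\beta+\gamma}(\mu)}\,X_{\beta+\gamma}(\mu).$$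
   Context: Notation. $(z)_k=\prod_{j=1}^k(1-zq^{j-1})$; $\binom{k}{l}_q=\frac{(q)_k}{(q)_l(q)_{k-l}}$ if $0\le l\le k$ and $0$ otherwise; $\theta(\text{true})=1$, $\theta(\text{false})=0$; $|\alpha|=\alpha_1+\alpha_2$. For $\alpha,\beta,\gamma,\delta\in\mathbb{Z}_{\ge0}^2$ put $$\Phi_q(\gamma|\beta;\lambda,\mu)=q^{(\beta_1-\gamma_1)\gamma_2}\Bigl(\frac{\mu}{\lambda}\Bigr)^{|\gamma|}\frac{(\lambda)_{|\gamma|}(\mu/\lambda)_{|\beta|-|\gamma|}}{(\mu)_{|\beta|}}\binom{\beta_1}{\gamma_1}_q\binom{\beta_2}{\gamma_2}_q$$ (which is $0$ unless $\gamma_i\le\beta_i$ for $i=1,2$), $$\mathscr{S}(\lambda,\mu)^{\gamma,\delta}_{\alpha,\beta}=\theta(\gamma+\delta=\alpha+\beta)\,\Phi_q(\gamma|\beta;\lambda,\mu),\qquad g_\alpha(\mu)=\frac{\mu^{-|\alpha|}(\mu)_{|\alpha|}}{(q)_{\alpha_1}(q)_{\alpha_2}}.$$ The $q$-boson operators act on the Fock space $F=\bigoplus_{m\ge0}\mathbb{C}|m\rangle$ by $\mathbf{b}_+|m\rangle=|m+1\rangle$, $\mathbf{b}_-|m\rangle=(1-q^m)|m-1\rangle$ (with $|-1\rangle=0$), $\mathbf{k}|m\rangle=q^m|m\rangle$; they satisfy $\mathbf{k}\mathbf{b}_\pm=q^{\pm1}\mathbf{b}_\pm\mathbf{k}$,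 $\mathbf{b}_+\mathbf{b}_-=1-\mathbf{k}$, $\mathbf{b}_-\mathbf{b}_+=1-q\mathbf{k}$. The ratio of infinite products is defined by its power series $\frac{(zw)_\infty}{(z)_\infty}=\sum_{j\ge0}\frac{(w)_j}{(q)_j}z^j$, so $$\frac{(\mathbf{b}_+)_\infty}{(\mu^{-1}\mathbf{b}_+)_\infty}=\sum_{j\ge0}\frac{(\mu)_j}{(q)_j}\mu^{-j}\mathbf{b}_+^j .$$ Power series in $\mathbf{b}_+$ and all products are understood as operators on the completed Fock space $\prod_{m\ge0}\mathbb{C}|m\rangle$ (to which $\mathbf{b}_\pm,\mathbf{k}$ extend componentwise), where every coefficient is a finite sum. *)

(* Defs.v *)
From mathcomp Require Import all_boot all_order all_algebra.
From mathcomp Require Import all_classical all_reals.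
From mathcomp Require Export complex.

Set Implicit Arguments.
Unset Strict Implicit.
Unset Printing Implicit Defensive.

Import Order.TTheory GRing.Theory Num.Theory.
Local Open Scope ring_scope.

Section Scalars.
Variables (R : realType) (q : R).

(* (z)_k, base q *)
Definition qpoch (z : R) (k : nat) : R := \prod_(j < k) (1 - z * q ^+ j).

Definition qbinom (k l : nat) : R :=
  if (l <= k)%N then qpoch q k / (qpoch q l * qpoch q (k - l)) else 0.

Definition weight (a : nat * nat) : nat := (a.1 + a.2)%N.

(* Phi_q(c | b; lam, mu).  The natural-number subtractions are genuine ones
   whenever c.1 <= b.1 and c.2 <= b.2; otherwise a q-binomial vanishes. *)
Definition Phi (c b : nat * nat) (lam mu : R) : R :=
  q ^+ ((b.1 - c.1) * c.2)%N * (mu / lam) ^+ weight c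
  * (qpoch lam (weight c) * qpoch (mu / lam) (weight b - weight c)
     / qpoch mu (weight b))
  * qbinom b.1 c.1 * qbinom b.2 c.2.

(* S(lam, mu)^{c,d}_{a,b}: the lower indices come first; nat * nat carries
   componentwise addition. *)
Definition Smx (lam mu : R) (a b c d : nat * nat) : R :=
  if c + d == a + b then Phi c b lam mu else 0.

Definition gfac (a : nat * nat) (mu : R) : R :=
  mu ^- weight a * qpoch mu (weight a) / (qpoch q a.1 * qpoch q a.2).

End Scalars.

(* The completed Fock space: v : nat -> C stands for the formal sum of the
   v m |m>. *)
Definition Fock (R : realType) : Type := nat -> R[i].

Section Operators.
Variables (R : realType) (q : R).
Implicit Types (v : Fock R) (a : nat * nat).

Definition ket (m : nat) : Fock R := fun n => (n == m)%:R.

Definition bplus : Fock R -> Fock R :=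
  fun v m => if m is m'.+1 then v m' else 0.

Definition bminus : Fock R -> Fock R :=
  fun v m => (1 - q ^+ m.+1)%:C%C * v m.+1.

Definition kop : Fock R -> Fock R := fun v m => (q ^+ m)%:C%C * v m.

Lemma bplus_ket m : bplus (ket m) = ket m.+1.
Proof. by apply/funext; case. Qed.

(* At m = 0 the coefficient vanishes, in accordance with |-1> = 0. *)
Lemma bminus_ket m : bminus (ket m) = (1 - q ^+ m)%:C%C *: ket m.-1.
Proof.
apply/funext => n; rewrite /bminus /ket.
change ((1 - q ^+ n.+1)%:C%C * (n.+1 == m)%:R
        = (1 - q ^+ m)%:C%C * (n == m.-1)%:R :> R[i]).
case: m => [|m] /=; first by rewrite mulr0 expr0 subrr mul0r.
by rewrite eqSS; case: eqVneq => [->|]; rewrite ?mulr0.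
Qed.

Lemma kop_ket m : kop (ket m) = (q ^+ m)%:C%C *: ket m.
Proof.
apply/funext => n; rewrite /kop /ket.
change ((q ^+ n)%:C%C * (n == m)%:R = (q ^+ m)%:C%C * (n == m)%:R :> R[i]).
by case: eqVneq => [->|]; rewrite ?mulr0.
Qed.

Lemma iter_bplus_small j v m : (m < j)%N -> iter j bplus v m = 0.
Proof. by elim: j m => [|j IHj] [|m] //= /IHj. Qed.

(* The power series sum_j c_j b_+^j.  By iter_bplus_small the terms with j > m
   do not contribute to the coefficient of |m>. *)
Definition bplus_series (c : nat -> R) : Fock R -> Fock R :=
  fun v m => \sum_(j < m.+1) (c j)%:C%C * iter j bplus v m.

(* (t w b_+)_oo / (t b_+)_oo, defined by its q-binomial series in t b_+ *)
Definition qratio_bplus (t w : R) : Fock R -> Fock R :=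
  bplus_series (fun j => qpoch q w j / qpoch q q j * t ^+ j).

Definition Zop a (mu : R) : Fock R -> Fock R :=
  qratio_bplus mu^-1 mu \o iter a.2 kop \o iter a.1 bminus.

Definition Xop a (mu : R) : Fock R -> Fock R :=
  (gfac q a mu)%:C%C \*: Zop a mu.

End Operators.

(* The support of Smx in its lower indices is finite, so that summing over it
   with the finitely supported sum of fsbigop is a genuine sum. *)
Lemma finite_Smx_support (R : realType) (q lam mu : R) (c d : nat * nat) :
  finite_set [set p : (nat * nat) * (nat * nat) |
    Smx q lam mu p.1 p.2 c d != 0]%classic.
Proof.
pose s := c + d.
apply: (@sub_finite_set _ _ (((`I_s.1.+1 `*` `I_s.2.+1)
                          `*` (`I_s.1.+1 `*` `I_s.2.+1))%classic)); last first.
  by do !apply: finite_setX; exact: finite_II.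
move=> [[a1 a2] [b1 b2]]; rewrite /Smx /= /s.
case: (c + d =P _) => [E _|_]; last by rewrite eqxx.
move: (congr1 fst E) (congr1 snd E) => /= -> ->.
by do !split; rewrite ltnS ?leq_addr ?leq_addl.
Qed.

(* Main.v *)
(* Let z = b_+, and for a scalar x put T = k + x b_-.  With
   U = (1 - z)^-1 (x - z) k and V = T - U one finds z V = x - U, hence
   V U = q U V, and conjugation by f_lam = (b_+)_oo / (lam^-1 b_+)_oo sends T to
   the point V + lam^-1 U of the line spanned by V and U.  Powers of such points
   obey an interpolation identity, homogeneous in three points of the line, that
   follows by induction from the q-commutation of U and V.  Multiplying it by
   f_lam f_mu, expanding the powers of T by the q-binomial theorem and comparing
   coefficients of powers of x gives the Zamolodchikov-Faddeev relation for
   beta = 0.  General beta only adds the right factor k^beta_2 b_-^beta_1, since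
   the denominators and (mu)_|delta| of Phi cancel against g_delta(mu).  The
   auxiliary condition is immediate, because X_0(lam) = f_lam cancels and b_-
   q-commutes with k. *)
From HB Require Import structures.
Require Import Defs.
From mathcomp Require Import all_boot all_order all_algebra.
From mathcomp Require Import all_classical all_reals ring.

Set Implicit Arguments.
Unset Strict Implicit.
Unset Printing Implicit Defensive.

Import Order.TTheory GRing.Theory Num.Theory.
Local Open Scope ring_scope.

(** * Interpolation on a q-commuting line *)

Section Interpolation.
Variables (F : fieldType) (E : algType F) (q : F).
Hypothesis q_neq0 : q != 0.
Hypothesis q_not_root1 : forall n, 1 - q ^+ n.+1 != 0.
Implicit Types (u v w x : F).

Definition qfac n : F := \prod_(j < n) (1 - q ^+ j.+1).

(** The homogeneous shifted factorial: it equals v^n (u/v)_n for nonzero [v], but is polynomial in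
    both arguments, so no division by a parameter occurs. *)
Definition qdiff v u n : F := \prod_(j < n) (v - u * q ^+ j).

Lemma qfacS n : qfac n.+1 = qfac n * (1 - q ^+ n.+1).
Proof. by rewrite /qfac big_ord_recr. Qed.

Lemma qfac_neq0 n : qfac n != 0.
Proof. by apply/prodf_neq0 => j _; exact: q_not_root1. Qed.

Lemma qdiff0 v u : qdiff v u 0 = 1.
Proof. by rewrite /qdiff big_ord0. Qed.

Lemma qdiffS v u n : qdiff v u n.+1 = qdiff v u n * (v - u * q ^+ n).
Proof. by rewrite /qdiff big_ord_recr. Qed.

Lemma qdiffSl v u n : qdiff v u n.+1 = (v - u) * qdiff v (u * q) n.
Proof.
rewrite /qdiff big_ord_recl expr0 mulr1; congr (_ * _).
by apply: eq_bigr => j _; rewrite -mulrA -exprS.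
Qed.

(** The rearrangement behind Pascal-type inductions: each interior term of the longer sum collects
    one [X] and one [Y], while the two end terms collect only one of them. *)
Lemma big_ordS_split (M : nmodType) n (X Y Z : nat -> M) :
    Z 0 = X 0 -> (forall m, (m < n)%N -> Z m.+1 = X m.+1 + Y m) ->
    Z n.+1 = Y n ->
  \sum_(m < n.+2) Z m = \sum_(m < n.+1) (X m + Y m).
Proof.
move=> Z0 ZS Zn; rewrite big_ord_recl big_ord_recr/= Z0 Zn.
under eq_bigr => m _ do rewrite /bump/= add1n ZS//.
rewrite !big_split/= [in RHS]big_ord_recl.
by rewrite [\sum_(i < n.+1) Y i]big_ord_recr/= !addrA.
Qed.

Section QPlane.
Variables U V : E.
Hypothesis VU : V * U = q *: (U * V).

Definition qline w : E := V + w *: U.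

(** By [VU] the left side expands to V^2 + q(a + b) U V + q a b U^2, which is symmetric in [a] and
    [b]. *)
Lemma qlineM a b : qline (q * a) * qline b = qline (q * b) * qline a.
Proof.
rewrite /qline !mulrDl !mulrDr -!scalerAl -!scalerAr VU !scalerA.
rewrite -!addrA; congr (_ + _); rewrite !addrA; congr (_ + _).
  by rewrite [RHS]addrC [q * a]mulrC [q * b]mulrC.
by congr (_ *: _); ring.
Qed.

Lemma qlineXM u w m :
  qline (q * u) ^+ m * qline w = qline (q ^+ m * w) * qline u ^+ m.
Proof.
elim: m => [|m IHm]; first by rewrite !expr0 !mul1r mulr1.
by rewrite exprS -mulrA IHm mulrA qlineM mulrA -exprS -mulrA -exprS.
Qed.

Lemma qline_affine v u w :
  (v - u) *: qline w = (w - u) *: qline v + (v - w) *: qline u.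
Proof.
rewrite /qline !scalerDr !scalerA addrACA -!scalerDl.
by congr (_ *: _ + _ *: _); ring.
Qed.

(** Induction on [n], with the hypothesis taken at [u * q]. The additional factor [qline w] moves
    left past the power of [qline (q * u)] by [qlineXM], becoming the point q^m w, and
    [qline_affine] then splits it between the points [v] and [u]. *)
Lemma qline_interpolation v u w n :
  (qdiff v u n / qfac n) *: qline w ^+ n =
  \sum_(m < n.+1) (qdiff w u (n - m) * qdiff v w m / (qfac (n - m) * qfac m))
    *: (qline v ^+ (n - m) * qline u ^+ m).
Proof.
elim: n u => [|n IHn] u.
  by rewrite big_ord1 !qdiff0 !expr0 /qfac big_ord0 !mulr1 invr1.
have nz := qfac_neq0; have nzS := q_not_root1.
apply: (scalerI (nzS n)); rewrite scalerA.
(* The factor [v - u] is set aside for [qline_affine]; the rest is the prefactor in the induction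
   hypothesis. *)
have -> : (1 - q ^+ n.+1) * (qdiff v u n.+1 / qfac n.+1)
          = (v - u) * (qdiff v (u * q) n / qfac n).
  by rewrite qfacS qdiffSl; field; rewrite nz nzS.
rewrite exprSr -scalerA scalerAl IHn mulr_suml scaler_sumr [in RHS]scaler_sumr.
pose a m := qdiff w (u * q) (n - m) * qdiff v w m / (qfac (n - m) * qfac m).
pose X m := (a m * (q ^+ m * w - u)) *: (qline v ^+ (n - m).+1 * qline u ^+ m).
pose Y m := (a m * (v - q ^+ m * w)) *: (qline v ^+ (n - m) * qline u ^+ m.+1).
transitivity (\sum_(m < n.+1) (X m + Y m)).
  apply: eq_bigr => m _; rewrite -/(a m).
  rewrite -scalerAl -[_ * _ * qline w]mulrA [u * q]mulrC qlineXM scalerA.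
  rewrite [_ * a m]mulrC -scalerA [X in a m *: X]scalerAr.
  rewrite [X in a m *: (_ * X)]scalerAl qline_affine mulrDl mulrDr.
  rewrite -!scalerAl -!scalerAr.
  rewrite scalerDr !scalerA /X /Y !mulrA -exprSr -!mulrA -exprS.
  by congr (_ + _).
rewrite -(@big_ordS_split _ _ X Y (fun m => (1 - q ^+ n.+1) *:
  ((qdiff w u (n.+1 - m) * qdiff v w m / (qfac (n.+1 - m) * qfac m))
    *: (qline v ^+ (n.+1 - m) * qline u ^+ m)))) //.
- rewrite /X /a !subn0 scalerA; congr (_ *: _).
  rewrite qdiffSl qdiff0 qfacS /qfac big_ord0 -/(qfac n).
  by field; rewrite nz nzS.
- move=> m ltmn; rewrite /X /Y /a subSS.
  have -> : (n - m = (n - m.+1).+1)%N by rewrite subnSK.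
  rewrite !scalerA -scalerDl; congr (_ *: _).
  (* With P = q^(n-m) and M = q^(m+1), so that P M = q^(n+1), the two contributions add up through
     (1 - P)(M w - u) + (1 - M)(w - P u) = (1 - P M)(w - u). *)
  have En : q ^+ n.+1 = q ^+ m.+1 * q ^+ (n - m.+1).+1.
    by rewrite -exprD; congr (q ^+ _); rewrite addnS subnKC.
  rewrite En [qdiff w u _]qdiffSl [qdiff w (u * q) (_).+1]qdiffS qdiffS !qfacS.
  rewrite (exprS q (n - _)) (exprS q m).
  have := nzS m; have := nzS (n - m.+1)%N; rewrite !exprS => h1 h2.
  by field; rewrite !nz h1 h2.
rewrite /Y /a !subnn scalerA; congr (_ *: _).
rewrite !qdiff0 [qdiff _ _ _.+1]qdiffS qfacS /qfac big_ord0 -/(qfac n).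
by field; rewrite nz nzS.
Qed.

End QPlane.

(** The coefficient of x^a in (K + x A)^(a+b) / (q)_(a+b), with [K] ordered to the left, when
    [A * K] is [q] times [K * A]. *)
Definition qmonom (K A : E) (a b : nat) : E :=
  (qfac a * qfac b)^-1 *: (K ^+ b * A ^+ a).

Lemma q_binomial_theorem (K A : E) x n : A * K = q *: (K * A) ->
  (qfac n)^-1 *: (K + x *: A) ^+ n
  = \sum_(a < n.+1) x ^+ a *: qmonom K A a (n - a).
Proof.
move=> AK; have nz := qfac_neq0; have nzS := q_not_root1.
have AKX b : A * K ^+ b = q ^+ b *: (K ^+ b * A).
  elim: b => [|b IHb]; first by rewrite expr0 mulr1 mul1r scale1r.
  by rewrite exprSr mulrA IHb -scalerAl -2!mulrA AK -scalerAr scalerA -exprSr.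
elim: n => [|n IHn].
  by rewrite big_ord1 /qmonom /qfac !big_ord0 !expr0 !mulr1 scale1r.
apply: (scalerI (nzS n)); rewrite scalerA qfacS invfM mulrCA mulfV// mulr1.
rewrite exprS scalerAr IHn mulr_sumr [in RHS]scaler_sumr.
pose X a : E := x ^+ a *: ((qfac a * qfac (n - a))^-1
  *: (K ^+ (n - a).+1 * A ^+ a)).
pose Y a : E := x ^+ a.+1 *: ((qfac a * qfac (n - a))^-1 * q ^+ (n - a)
  *: (K ^+ (n - a) * A ^+ a.+1)).
transitivity (\sum_(a < n.+1) (X a + Y a)).
  apply: eq_bigr => a _; rewrite /X /Y /qmonom -!scalerAr mulrDl -scalerAl.
  rewrite !mulrA AKX -exprS -scalerAl -mulrA -exprS !scalerDr !scalerA.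
  by congr (_ + _ *: _); rewrite exprSr -!mulrA; congr (_ * _); ring.
rewrite -(@big_ordS_split _ _ X Y (fun a => (1 - q ^+ n.+1) *:
  (x ^+ a *: qmonom K A a (n.+1 - a)))) // /qmonom.
- rewrite /X !subn0 !scalerA; congr (_ *: _).
  rewrite qfacS /qfac big_ord0 -/(qfac n).
  by field; rewrite nz nzS.
- move=> a ltan; rewrite /X /Y subSS.
  have -> : (n - a = (n - a.+1).+1)%N by rewrite subnSK.
  rewrite !scalerA -scalerDl; congr (_ *: _).
  (* This is the q-Pascal rule 1 - q^(n+1) = (1 - q^(n-a)) + q^(n-a) (1 - q^(a+1)). *)
  have -> : q ^+ n.+1 = q ^+ a.+1 * q ^+ (n - a.+1).+1.
    by rewrite -exprD; congr (q ^+ _); rewrite addnS subnKC.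
  rewrite !qfacS.
  have := nzS a; have := nzS (n - a.+1)%N => h1 h2.
  by field; rewrite !nz h1 h2.
rewrite /Y !subnn !scalerA; congr (_ *: _).
rewrite qfacS /qfac big_ord0 -/(qfac n) expr0.
by field; rewrite nz nzS.
Qed.

Lemma coef_unique (M : lmodType F) n (c d : nat -> M) :
  (forall x, \sum_(a < n) x ^+ a *: c a = \sum_(a < n) x ^+ a *: d a) ->
  forall a, (a < n)%N -> c a = d a.
Proof.
(* Subtracting q^n times the relation at x from the relation at q x removes
   the top coefficient. *)
have sum0 : forall n (c : nat -> M), (forall x, \sum_(a < n) x ^+ a *: c a = 0) ->
    forall a, (a < n)%N -> c a = 0.
  move=> {c d} {}n; elim: n => [//|n IHn] c c0.
  have clt a : (a < n)%N -> c a = 0.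
    move=> ltan.
    have step x : \sum_(a < n) x ^+ a *: ((q ^+ a - q ^+ n) *: c a) = 0.
      have := c0 (q * x); have /(congr1 ( *:%R (q ^+ n))) := c0 x.
      rewrite scaler0 !big_ord_recr/= => h1 h2.
      rewrite -[RHS](subrr (0 : M)) -[X in _ = X - _]h2 -[X in _ = _ - X]h1.
      rewrite scalerDr scalerA exprMn [X in _ - X]addrC addrKA.
      rewrite scaler_sumr -sumrB; apply: eq_bigr => i _.
      by rewrite !scalerA -scalerBl exprMn; congr (_ *: _); ring.
    have /eqP := IHn (fun a => (q ^+ a - q ^+ n) *: c a) step a ltan.
    rewrite scaler_eq0 => /orP[|/eqP//].
    (* The scalar is q^a (1 - q^(n-a)) up to sign conventions of none: both factors are nonzero by
       the hypotheses on [q]. *)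
    by rewrite -(subnK (ltnW ltan)) addnC exprD -{1}[q ^+ a]mulr1 -mulrBr mulf_eq0
      expf_eq0 (negPf q_neq0) andbF/= -(subnSK ltan) (negPf (q_not_root1 _)).
  move=> a; rewrite ltnS leq_eqVlt => /orP[/eqP->|/clt//].
  have := c0 1; rewrite big_ord_recr/= expr1n scale1r big1 ?add0r// => i _.
  by rewrite clt ?scaler0.
move=> cd a ltan; apply/eqP; rewrite -subr_eq0; apply/eqP.
apply: (sum0 _ (fun a => c a - d a)) ltan => x.
by under eq_bigr do rewrite scalerBr; rewrite sumrB cd subrr.
Qed.

End Interpolation.

(** * Exchange relation for dressed q-boson words *)

Lemma sum_triangle (M : nmodType) n (G : nat -> nat -> M) :
  \sum_(m < n.+1) \sum_(i < m.+1) G i (m - i)%N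
  = \sum_(i < n.+1) \sum_(j < (n - i).+1) G i j.
Proof.
elim: n => [|n IHn]; first by rewrite !big_ord1.
rewrite big_ord_recr/= IHn [RHS]big_ord_recr/= subnn big_ord1.
rewrite [X in _ + X]big_ord_recr/= subnn addrA; congr (_ + _).
rewrite -big_split; apply: eq_bigr => i _ /=.
by rewrite subSn ?[RHS]big_ord_recr -1?ltnS.
Qed.

Lemma exchange_triangle (M : nmodType) n (G : nat -> nat -> M) :
  \sum_(i < n.+1) \sum_(j < (n - i).+1) G i j
  = \sum_(j < n.+1) \sum_(i < (n - j).+1) G i j.
Proof.
rewrite -sum_triangle -(sum_triangle _ (fun j i => G i j)).
apply: eq_bigr => m _; rewrite (reindex_inj rev_ord_inj).
by apply: eq_bigr => i _ /=; rewrite subSS subKn// -ltnS.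
Qed.

Section Exchange.
Variables (F : fieldType) (E : algType F) (q : F).
Hypothesis q_neq0 : q != 0.
Hypothesis q_not_root1 : forall n, 1 - q ^+ n.+1 != 0.
Implicit Types (u v w x : F).

Variables z k B Y : E.
Hypotheses (zreg : GRing.lreg z) (zB : z * B = 1 - k) (kz : k * z = q *: (z * k))
  (Bk : B * k = q *: (k * B)) (YK : (1 - z) * Y = 1) (KY : Y * (1 - z) = 1).

Let zreg1 : GRing.lreg (1 - z).
Proof. by move=> a b /(congr1 ( *%R Y)); rewrite !mulrA KY !mul1r. Qed.

Let zcommx x : GRing.comm z (x%:A - z).
Proof.
by apply: commrB => //; rewrite /GRing.comm -scalerAr -scalerAl mulr1 mul1r.
Qed.

Let comm1z e u : GRing.comm z e -> (1 - u *: z) * e = e * (1 - u *: z).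
Proof.
by move=> ze; rewrite mulrBl mulrBr mul1r mulr1 -scalerAl -scalerAr ze.
Qed.

Let comm1 e : GRing.comm z e -> (1 - z) * e = e * (1 - z).
Proof. by move=> ze; rewrite mulrBl mulrBr mul1r mulr1 ze. Qed.

Definition rotU x : E := Y * ((x%:A - z) * k).
Definition rotV x : E := k + x *: B - rotU x.

Let rotUE x : (1 - z) * rotU x = (x%:A - z) * k.
Proof. by rewrite /rotU mulrA YK mul1r. Qed.

(** By [zB], the product of [z] with [k + x *: B] is x - (x - z) k, and (x - z) k = (1 - z) U by
    [rotUE]; subtracting z U leaves x - U. *)
Lemma z_rotV x : z * rotV x = x%:A - rotU x.
Proof.
have := rotUE x; rewrite !mulrBl mul1r -scalerAl mul1r => UE.
have {}UE : rotU x = x *: k - z * k + z * rotU x by rewrite -UE subrK.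
rewrite [in RHS]UE /rotV mulrBr mulrDr -scalerAr zB scalerBr opprD !addrA.
by congr (_ - _); rewrite opprB addrA [z * k + _]addrC.
Qed.

Lemma rotUz x : rotU x * z = q *: (z * rotU x).
Proof.
move: (rotU x) (rotUE x) => U UE.
apply: zreg1; rewrite mulrA UE -mulrA kz -!scalerAr; congr (_ *: _).
rewrite !mulrA -zcommx -!mulrA -UE !mulrA; congr (_ * _).
by rewrite mulrBl mulrBr mul1r mulr1.
Qed.

(** After multiplication by the cancellable [z] on the left, [z_rotV] and [rotUz] turn both sides
    into (x - U) U. *)
Lemma rotVU x : rotV x * rotU x = q *: (rotU x * rotV x).
Proof.
have := z_rotV x; have := rotUz x; move: (rotU x) (rotV x) => U V Uz zV.
apply: zreg; rewrite -scalerAr [LHS]mulrA zV [X in q *: X]mulrA scalerAl -Uz.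
by rewrite -mulrA zV mulrBl mulrBr -scalerAl -scalerAr mul1r mulr1.
Qed.

(** For a power series h in [z], the last hypothesis encodes the functional equation (1 - z) h(q z)
    = (1 - u z) h(z). Multiplying the claim by [z] on the left replaces [k + x *: B] by x - (x - z)
    k, so only the conjugate of [k] has to be computed. *)
Lemma conj_qline x h h' u :
    h' * h = 1 -> h * h' = 1 -> z * h = h * z ->
    (1 - z) * (k * h) = (1 - u *: z) * (h * k) ->
  h' * (k + x *: B) * h = qline (rotU x) (rotV x) u.
Proof.
move=> hK Kh zh kh.
have zh' : GRing.comm z h'.
  rewrite /GRing.comm -[z * h']mul1r -hK -mulrA [h * _]mulrA -zh.
  by rewrite -mulrA Kh mulr1.
(* After multiplication by 1 - z, the hypothesis [kh] applies; the remaining factors [h'], x - z and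
   1 - u z commute with [z]. *)
have khE : (x%:A - z) * (h' * (k * h)) = rotU x - u *: (z * rotU x).
  move: (rotU x) (rotUE x) => U UE.
  rewrite -{1}[U]mul1r scalerAl -mulrBl; apply: zreg1.
  transitivity ((x%:A - z) * (h' * ((1 - z) * (k * h)))).
    rewrite [LHS]mulrA (comm1 (zcommx x)) -[LHS]mulrA; congr (_ * _).
    by rewrite [LHS]mulrA (comm1 zh') -[LHS]mulrA.
  transitivity ((x%:A - z) * ((1 - u *: z) * (h' * h * k))).
    rewrite kh; congr (_ * _).
    by rewrite -[h' * h * k]mulrA [LHS]mulrA -(comm1z u zh') -[LHS]mulrA.
  rewrite hK mul1r [LHS]mulrA -(comm1z u (zcommx x)) -[LHS]mulrA -UE.
  rewrite [LHS]mulrA [RHS]mulrA; congr (_ * _).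
  by apply: comm1z; apply: commrB; first exact: commr1.
have zT : z * (k + x *: B) = x%:A - (x%:A - z) * k.
  rewrite mulrDr -scalerAr zB mulrBl -scalerAl mul1r opprB scalerBr.
  by rewrite addrC addrAC addrA.
apply: zreg; rewrite /qline [RHS]mulrDr -scalerAr z_rotV.
transitivity (h' * (x%:A - (x%:A - z) * k) * h).
  by rewrite -zT [in RHS]mulrA -zh' -!mulrA.
have h'x : h' * (x%:A - z) = (x%:A - z) * h'.
  by rewrite mulrBr mulrBl zh' -scalerAr -scalerAl mulr1 mul1r.
rewrite mulrBr mulrBl -scalerAr mulr1 -scalerAl hK [h' * (_ * k)]mulrA h'x.
by rewrite -!mulrA khE opprB addrA addrAC.
Qed.

(** This is the interpolation identity with [u] equal to 1: T = [k + x *: B] is itself the point 1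
    of the line, and its conjugates by [f] and [g] are the points [w] and [v]. *)
Lemma exchange_relation f f' g g' v w a b :
    f' * f = 1 -> f * f' = 1 -> z * f = f * z ->
    (1 - z) * (k * f) = (1 - w *: z) * (f * k) ->
    g' * g = 1 -> g * g' = 1 -> z * g = g * z ->
    (1 - z) * (k * g) = (1 - v *: z) * (g * k) ->
    f * g = g * f ->
  qdiff q v 1 (a + b) *: (g * qmonom q k B a b * f)
  = \sum_(i < a.+1) \sum_(j < b.+1)
      (qdiff q w 1 (a + b - (i + j)) * qdiff q v w (i + j)) *:
      (f * qmonom q k B (a - i) (b - j) * g * qmonom q k B i j).
Proof.
move=> fK Kf zf kf gK Kg zg kg fg; have nz := qfac_neq0 q_not_root1.
pose H n i j i' j' := (qdiff q w 1 (n - (i + j)) * qdiff q v w (i + j)) *: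
  (f * qmonom q k B i' j' * g * qmonom q k B i j).
set n := (a + b)%N.
pose L a := qdiff q v 1 n *: (g * qmonom q k B a (n - a) * f).
pose G a := \sum_(i < a.+1) \sum_(j < (n - a).+1) H n i j (a - i)%N (n - a - j)%N.
have leab : (a < n.+1)%N by rewrite ltnS leq_addr.
(* All pairs with sum [n] are treated together, as the coefficients of x^a in a single identity of
   degree [n]. *)
suff: L a = G a by rewrite /L /G /H /n addKn.
apply: (coef_unique q_neq0 q_not_root1) leab => x.
pose T := k + x *: B.
pose P m := \sum_(i < m.+1) x ^+ i *: qmonom q k B i (m - i).
have TX m : T ^+ m = qfac q m *: P m.
  by rewrite /P -(q_binomial_theorem q_not_root1)// scalerA mulfV// scale1r.
have conjX h h' m : h' * h = 1 -> h * h' = 1 ->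
    (h' * T * h) ^+ m = h' * T ^+ m * h.
  move=> hK Kh; elim: m => [|m IHm]; first by rewrite !expr0 mulr1 hK.
  by rewrite !exprS IHm -!mulrA [h * (h' * _)]mulrA Kh mul1r.
transitivity (qdiff q v 1 n *: (g * P n * f)).
  rewrite mulr_sumr mulr_suml scaler_sumr; apply: eq_bigr => i _.
  by rewrite -scalerAr -scalerAl !scalerA mulrC.
transitivity (\sum_(m < n.+1) (qdiff q w 1 (n - m) * qdiff q v w m) *:
   (f * P (n - m)%N * g * P m)).
  have := qline_interpolation q_not_root1 (rotVU x) v 1 w n.
  rewrite -(conj_qline x fK Kf zf kf) -(conj_qline x gK Kg zg kg) -/T.
  have -> : qline (rotU x) (rotV x) 1 = T by rewrite /qline scale1r /rotV subrK.
  (* Left multiplication by f g removes the inverses: the left side becomes g T^n f, because f and g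
     commute, and each summand becomes f T^(n-m) g T^m. *)
  rewrite conjX// => /(congr1 ( *%R (f * g))).
  rewrite {1}fg -scalerAr !mulrA -[_ * f * f']mulrA Kf mulr1 TX.
  rewrite -scalerAr -scalerAl scalerA divfK// => ->.
  rewrite mulr_sumr; apply: eq_bigr => m _.
  rewrite -scalerAr conjX// !TX !mulrA -[_ * g * g']mulrA Kg mulr1.
  rewrite -!scalerAr -!scalerAl !scalerA; congr (_ *: _).
  by field; rewrite !nz.
(* The triple sum is regrouped: the outer index changes from i + j, the degree of the right-hand
   word, to i + i', the power of [x]. *)
pose K i j i' := x ^+ (i + i') *: H n i j i' (n - i - j - i')%N.
transitivity (\sum_(m < n.+1) \sum_(i < m.+1) \sum_(i' < (n - m).+1)
    K i (m - i)%N i').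
  apply: eq_bigr => m _; rewrite mulr_sumr scaler_sumr.
  apply: eq_bigr => i _; rewrite !(mulr_sumr, mulr_suml) scaler_sumr.
  have leim : (i <= m)%N by rewrite -ltnS.
  apply: eq_bigr => i' _; rewrite /K /H -[(n - i - _)%N]subnDA subnKC// exprD.
  by rewrite -!scalerAr -!scalerAl !scalerA; congr (_ *: _); ring.
transitivity (\sum_(i < n.+1) \sum_(j < (n - i).+1) \sum_(i' < (n - i - j).+1)
    K i j i').
  rewrite -(sum_triangle _ (fun i j => \sum_(i' < (n - i - j).+1) K i j i')).
  apply: eq_bigr => m _; apply: eq_bigr => i _.
  by rewrite -subnDA subnKC// -ltnS.
under eq_bigr => i _ do rewrite (exchange_triangle _ (fun j i' => K i j i')).
rewrite -(sum_triangle _ (fun i i' => \sum_(j < (n - i - i').+1) K i j i')).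
apply: eq_bigr => m _; rewrite scaler_sumr; apply: eq_bigr => i _.
have leim : (i <= m)%N by rewrite -ltnS.
rewrite -subnDA subnKC// scaler_sumr; apply: eq_bigr => j _.
rewrite /K subnKC//; congr (_ *: H _ _ _ _ _).
by rewrite [LHS]subnAC -[(n - i - _)%N]subnDA subnKC.
Qed.

End Exchange.

(** * The algebra of linear operators on the completed Fock space *)

Section FockOperators.
Variable R : realType.
Local Notation C := R[i].

Definition linear_pred : {pred Fock R -> Fock R} :=
  fun f => `[< linear f >].

Lemma linear_pred_submod : submod_closed linear_pred.
Proof.
split=> [|a f g /asboolP lf /asboolP lg]; apply/asboolP => c u v.
  by rewrite [RHS]addr0 scaler0.
have E w : (a *: f + g) w = a *: f w + g w by [].
by rewrite !E lf lg !scalerDr !scalerA [a * c]mulrC addrACA.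
Qed.

HB.instance Definition _ := GRing.isSubmodClosed.Build C _ linear_pred
  linear_pred_submod.

(** As a subtype of all maps it inherits the pointwise module structure; with composition as product
    it becomes an algebra over the complex numbers, to which [exchange_relation] applies. *)
Record fock_op := FockOp {fock_fun :> Fock R -> Fock R;
  fock_op_linear : fock_fun \in linear_pred}.

HB.instance Definition _ := [isSub for fock_fun].
HB.instance Definition _ := [Choice of fock_op by <:].
HB.instance Definition _ := [SubChoice_isSubLmodule of fock_op by <:].

Lemma fock_opP (a : fock_op) : linear a.
Proof. exact/asboolP/fock_op_linear. Qed.

HB.instance Definition _ (a : fock_op) :=
  GRing.isLinear.Build C (Fock R) (Fock R) *:%R (fock_fun a) (fock_opP a).

Lemma fock_op_ext (a b : fock_op) : fock_fun a = fock_fun b -> a = b.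
Proof. exact: val_inj. Qed.

Definition mkop (f : Fock R -> Fock R) (lf : linear f) : fock_op :=
  FockOp (introT (asboolP _) lf : f \in linear_pred).

Fact fock_id_linear : linear (idfun : Fock R -> Fock R).
Proof. by []. Qed.

Fact fock_comp_linear (a b : fock_op) : linear (a \o b).
Proof. by move=> c u v; rewrite /= !linearP. Qed.

Definition fock_one := mkop fock_id_linear.
Definition fock_mul a b := mkop (fock_comp_linear a b).

Fact fock_mulA : associative fock_mul.
Proof. by move=> a b c; apply: fock_op_ext. Qed.
Fact fock_mul1 : left_id fock_one fock_mul.
Proof. by move=> a; apply: fock_op_ext. Qed.
Fact fock_mulr1 : right_id fock_one fock_mul.
Proof. by move=> a; apply: fock_op_ext. Qed.
Fact fock_mulDl : left_distributive fock_mul +%R.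
Proof. by move=> a b c; apply: fock_op_ext. Qed.
Fact fock_mulDr : right_distributive fock_mul +%R.
Proof. by move=> a b c; apply: fock_op_ext; apply/funext => v; exact: linearD. Qed.
Fact fock_one_neq0 : fock_one != 0.
Proof.
apply/eqP => /(congr1 (fun a : fock_op => a (fun=> 1) 0%N)) /eqP.
by rewrite /= oner_eq0.
Qed.

HB.instance Definition _ := GRing.Zmodule_isNzRing.Build fock_op
  fock_mulA fock_mul1 fock_mulr1 fock_mulDl fock_mulDr fock_one_neq0.

Fact fock_scaleAl (c : C) (a b : fock_op) : c *: (a * b) = (c *: a) * b.
Proof. by apply: fock_op_ext. Qed.
HB.instance Definition _ := GRing.Lmodule_isLalgebra.Build C fock_op fock_scaleAl.

Fact fock_scaleAr (c : C) (a b : fock_op) : c *: (a * b) = a * (c *: b).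
Proof. by apply: fock_op_ext; apply/funext => v; rewrite [RHS]/= linearZ. Qed.
HB.instance Definition _ := GRing.Lalgebra_isAlgebra.Build C fock_op fock_scaleAr.

Lemma fock_mulE (a b : fock_op) : fock_fun (a * b) = a \o b.
Proof. by []. Qed.

Lemma fock_expE (a : fock_op) n : fock_fun (a ^+ n) = iter n a.
Proof.
apply/funext => v; elim: n => [//|n IHn]; by rewrite exprS/= -IHn.
Qed.

Lemma fock_sumE (I : Type) (r : seq I) (P : pred I) (a : I -> fock_op) :
  fock_fun (\sum_(i <- r | P i) a i) = \sum_(i <- r | P i) fock_fun (a i).
Proof. exact: (big_morph fock_fun). Qed.

End FockOperators.

(** * Power series in the creation operator *)

Section PowerSeries.
Variables (R : realType) (q : R).
Local Notation C := R[i].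
Implicit Types (c d : nat -> R) (v : Fock R).

Lemma iter_bplusE j v m :
  iter j (@bplus R) v m = if (j <= m)%N then v (m - j)%N else 0.
Proof. by elim: j m => [|j IHj] [|m] //=; rewrite ?subn0 ?IHj. Qed.

Lemma bplus_seriesE c v m :
  bplus_series c v m = \sum_(j < m.+1) (c j)%:C%C * v (m - j)%N.
Proof. by apply: eq_bigr => j _; rewrite iter_bplusE -ltnS ltn_ord. Qed.

Fact bplus_linear : linear (@bplus R).
Proof.
move=> a u v; apply/funext => -[|m] //=.
by change (0 = a * 0 + 0 :> C); rewrite mulr0 addr0.
Qed.

Fact bminus_linear : linear (bminus q).
Proof.
move=> a u v; apply/funext => m.
change ((1 - q ^+ m.+1)%:C%C * (a * u m.+1 + v m.+1)
  = a * ((1 - q ^+ m.+1)%:C%C * u m.+1) + (1 - q ^+ m.+1)%:C%C * v m.+1).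
by rewrite mulrDr mulrCA.
Qed.

Fact kop_linear : linear (kop q).
Proof.
move=> a u v; apply/funext => m.
change ((q ^+ m)%:C%C * (a * u m + v m)
  = a * ((q ^+ m)%:C%C * u m) + (q ^+ m)%:C%C * v m).
by rewrite mulrDr mulrCA.
Qed.

Fact bplus_series_linear c : linear (bplus_series c).
Proof.
move=> a u v; apply/funext => m.
change (bplus_series c (a *: u + v) m = a * bplus_series c u m + bplus_series c v m).
rewrite !bplus_seriesE mulr_sumr -big_split; apply: eq_bigr => j _ /=.
by change ((c j)%:C%C * (a * u (m - j)%N + v (m - j)%N)
  = a * ((c j)%:C%C * u (m - j)%N) + (c j)%:C%C * v (m - j)%N);
  rewrite mulrDr mulrCA.
Qed.

Definition bp_op : fock_op R := mkop bplus_linear.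
Definition bm_op : fock_op R := mkop bminus_linear.
Definition k_op : fock_op R := mkop kop_linear.
Definition series_op c : fock_op R := mkop (bplus_series_linear c).

Lemma fock_op_eqP (a b : fock_op R) : (forall v m, a v m = b v m) -> a = b.
Proof.
by move=> ab; apply: fock_op_ext; apply/funext => v; apply/funext => m.
Qed.

Lemma fock_addE (a b : fock_op R) v m : (a + b) v m = a v m + b v m.
Proof. by []. Qed.

Lemma fock_oppE (a : fock_op R) v m : (- a) v m = - a v m.
Proof. by []. Qed.

Lemma fock_scaleE (x : C) (a : fock_op R) v m : (x *: a) v m = x * a v m.
Proof. by []. Qed.

Lemma bp_op_lreg : GRing.lreg bp_op.
Proof.
move=> a b ab; apply: fock_op_eqP => v m.
by have := congr1 (fun e : fock_op R => e v m.+1) ab.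
Qed.

Lemma bp_bm : bp_op * bm_op = 1 - k_op.
Proof.
apply: fock_op_eqP => v m; rewrite fock_addE fock_oppE.
change (bplus (bminus q v) m = v m - (q ^+ m)%:C%C * v m).
case: m => [|m]; first by rewrite expr0 mul1r subrr.
by rewrite /= /bminus rmorphB rmorph1 mulrBl mul1r.
Qed.

Lemma k_bp : k_op * bp_op = q%:C%C *: (bp_op * k_op).
Proof.
apply: fock_op_eqP => v m; rewrite fock_scaleE.
change ((q ^+ m)%:C%C * bplus v m = q%:C%C * bplus (kop q v) m).
case: m => [|m]; first by rewrite !mulr0.
by rewrite /= /kop exprS rmorphM mulrA.
Qed.

Lemma bm_k : bm_op * k_op = q%:C%C *: (k_op * bm_op).
Proof.
apply: fock_op_eqP => v m; rewrite fock_scaleE.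
change ((1 - q ^+ m.+1)%:C%C * ((q ^+ m.+1)%:C%C * v m.+1) =
  q%:C%C * ((q ^+ m)%:C%C * ((1 - q ^+ m.+1)%:C%C * v m.+1))).
by rewrite mulrCA exprS rmorphM -mulrA.
Qed.

(** Moving [k_op] past the j-th power of b_+ costs q^j, so [k_op] acts on series by the dilation z
    -> q z. *)
Lemma k_series c : k_op * series_op c = series_op (fun j => c j * q ^+ j) * k_op.
Proof.
apply: fock_op_eqP => v m.
change ((q ^+ m)%:C%C * bplus_series c v m =
  bplus_series (fun j => c j * q ^+ j) (kop q v) m).
rewrite !bplus_seriesE mulr_sumr; apply: eq_bigr => j _.
have lejm : (j <= m)%N by rewrite -ltnS.
rewrite /kop -{1}(subnK lejm) exprD !rmorphM; ring.
Qed.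

Definition conv c d n := \sum_(j < n.+1) c j * d (n - j)%N.

Lemma convC c d : conv c d = conv d c.
Proof.
apply/funext => n; rewrite /conv (reindex_inj rev_ord_inj).
by apply: eq_bigr => i _ /=; rewrite subSS mulrC subKn // -ltnS.
Qed.

Lemma series_opM c d : series_op c * series_op d = series_op (conv c d).
Proof.
apply: fock_op_eqP => v m.
change (bplus_series c (bplus_series d v) m = bplus_series (conv c d) v m).
rewrite !bplus_seriesE.
under eq_bigr do rewrite bplus_seriesE mulr_sumr.
rewrite -(sum_triangle _ (fun j i => (c j)%:C%C * ((d i)%:C%C * v (m - j - i)%N))).
apply: eq_bigr => n _; rewrite rmorph_sum mulr_suml; apply: eq_bigr => j _.
have lejn : (j <= n)%N by rewrite -ltnS.
by rewrite rmorphM mulrA -subnDA subnKC.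
Qed.

Lemma series_op1 : series_op (fun j => (j == 0%N)%:R) = 1.
Proof.
apply: fock_op_eqP => v m.
change (bplus_series (fun j => (j == 0%N)%:R) v m = v m).
rewrite bplus_seriesE big_ord_recl big1 ?addr0 ?subn0 ?mul1r// => i _.
by rewrite mul0r.
Qed.

Lemma bp_opE : bp_op = series_op (fun j => (j == 1%N)%:R).
Proof.
apply: fock_op_eqP => v m.
change (bplus v m = bplus_series (fun j => (j == 1%N)%:R) v m).
rewrite bplus_seriesE; case: m => [|m]; first by rewrite big_ord1 mul0r.
rewrite !big_ord_recl mul0r add0r big1 ?addr0 ?subSS ?subn0 ?mul1r// => i _.
by rewrite mul0r.
Qed.

Lemma series_opC c d : series_op c * series_op d = series_op d * series_op c.
Proof. by rewrite !series_opM convC. Qed.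

Lemma bp_series c : bp_op * series_op c = series_op c * bp_op.
Proof. by rewrite bp_opE series_opC. Qed.

Lemma affine_series (u : R) c : (1 - u%:C%C *: bp_op) * series_op c =
  series_op (fun j => if j is j'.+1 then c j - u * c j' else c 0%N).
Proof.
apply: fock_op_eqP => v m.
rewrite mulrBl mul1r -scalerAl fock_addE fock_oppE fock_scaleE.
change (bplus_series c v m - u%:C%C * bplus (bplus_series c v) m =
  bplus_series (fun j => if j is j'.+1 then c j - u * c j' else c 0%N) v m).
rewrite !bplus_seriesE; case: m => [|m]; first by rewrite mulr0 subr0 !big_ord1.
rewrite /= bplus_seriesE big_ord_recl [RHS]big_ord_recl -addrA; congr (_ + _).
rewrite mulr_sumr -sumrB; apply: eq_bigr => i _.
by rewrite lift0 subSS rmorphB rmorphM mulrBl mulrA.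
Qed.

(** The first [n.+1] coefficients of the reciprocal of a series with constant term 1. A list is
    carried along because each new coefficient depends on all earlier ones. *)
Fixpoint inv_prefix c n : seq R :=
  if n is n'.+1 then
    let s := inv_prefix c n' in rcons s (- \sum_(j < n'.+1) c j.+1 * s`_(n' - j))
  else [:: 1].

Lemma series_op_inv c : c 0%N = 1 ->
  exists d, series_op d * series_op c = 1 /\ series_op c * series_op d = 1.
Proof.
move=> c0; pose d n := (inv_prefix c n)`_n.
have sz n : size (inv_prefix c n) = n.+1.
  by elim: n => [//|n IHn] /=; rewrite size_rcons IHn.
have dE n j : (j <= n)%N -> (inv_prefix c n)`_j = d j.
  elim: n => [|n IHn]; first by rewrite leqn0 => /eqP->.
  rewrite leq_eqVlt => /orP[/eqP-> //|ltjn].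
  by rewrite /= nth_rcons sz ltjn IHn.
have cd : conv c d = (fun j => (j == 0%N)%:R).
  apply/funext => -[|n]; rewrite /conv; first by rewrite big_ord1 c0 mul1r.
  rewrite big_ord_recl c0 mul1r subn0 {1}/d /= nth_rcons sz ltnn eqxx.
  apply/eqP; rewrite addrC subr_eq0; apply/eqP; apply: eq_bigr => j _.
  by rewrite /= /bump /= ?add1n subSS dE// leq_subr.
by exists d; rewrite !series_opM [conv d c]convC cd series_op1.
Qed.

End PowerSeries.

(** * Specialisation to the operators of the theorem *)

Section QFactors.
Variables (R : realType) (q : R).
Hypothesis hq : 0 < q < 1.
Local Notation C := R[i].

Lemma q_lt1_neq n : 1 - q ^+ n.+1 != 0.
Proof.
have /andP[q0 q1] := hq.
by rewrite subr_eq0 eq_sym lt_eqF// exprn_ilt1 // ltW.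
Qed.

Lemma qC_neq0 : q%:C%C != 0.
Proof. by rewrite fmorph_eq0 gt_eqF//; case/andP: hq. Qed.

Lemma qC_not_root1 n : 1 - q%:C%C ^+ n.+1 != 0 :> C.
Proof.
by rewrite -rmorphXn -(rmorph1 (real_complex R)) -rmorphB fmorph_eq0 q_lt1_neq.
Qed.

Lemma qpoch_qE n : qpoch q q n = qfac q n.
Proof. by apply: eq_bigr => j _; rewrite -exprS. Qed.

Lemma qpoch_neq0 z n : 0 < z < 1 -> qpoch q z n != 0.
Proof.
move=> /andP[z0 z1]; have /andP[q0 q1] := hq; apply/prodf_neq0 => j _.
rewrite subr_eq0 eq_sym lt_eqF// (le_lt_trans _ z1)//.
by rewrite ler_piMr ?(ltW z0)// exprn_ile1// ltW.
Qed.

Lemma qpoch_qdiff u z n : u != 0 -> u ^+ n * qpoch q (z / u) n = qdiff q u z n.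
Proof.
move=> u0; rewrite /qpoch /qdiff -[n in u ^+ n]card_ord -prodr_const -big_split.
by apply: eq_bigr => j _ /=; rewrite mulrBr mulr1 mulrA mulrCA divff ?mulr1.
Qed.

Lemma qdiffC u z n : (qdiff q u z n)%:C%C = qdiff q%:C%C u%:C%C z%:C%C n.
Proof.
by rewrite rmorph_prod; apply: eq_bigr => j _; rewrite rmorphB rmorphM rmorphXn.
Qed.

Lemma qfacC n : (qfac q n)%:C%C = qfac q%:C%C n.
Proof.
by rewrite rmorph_prod; apply: eq_bigr => j _; rewrite rmorphB rmorphXn rmorph1.
Qed.

Lemma gfacE a (mu : R) : mu != 0 ->
  gfac q a mu = qdiff q mu^-1 1 (weight a) / (qfac q a.1 * qfac q a.2).
Proof.
move=> mu0; rewrite /gfac !qpoch_qE -exprVn; congr (_ / _).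
by rewrite -qpoch_qdiff ?invr_eq0// invrK mul1r.
Qed.

Lemma gfacC a (mu : R) : mu != 0 -> (gfac q a mu)%:C%C =
  qdiff q%:C%C mu^-1%:C%C 1 (a.1 + a.2) / (qfac q%:C%C a.1 * qfac q%:C%C a.2).
Proof.
by move=> mu0; rewrite gfacE// rmorphM fmorphV rmorphM /= qdiffC !qfacC.
Qed.

(** The factors (mu)_|delta| and (q)_delta cancel. The powers of [mu] and [lam] recombine to
    lam^(-|b|) mu^(-(i+j)); the first belongs to [gfac q b lam], and the second makes (mu/lam)_(i+j)
    homogeneous. *)
Lemma Phi_gfac (lam mu : R) (b : nat * nat) i j : 0 < lam < 1 -> 0 < mu < 1 ->
  Phi q b (b.1 + i, b.2 + j)%N lam mu * gfac q (b.1 + i, b.2 + j)%N mu =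
  q ^+ (i * b.2) * gfac q b lam *
  (qdiff q mu^-1 lam^-1 (i + j) / (qfac q i * qfac q j)).
Proof.
move=> hlam hmu.
have lam0 : lam != 0 by rewrite gt_eqF//; case/andP: hlam.
have mu0 : mu != 0 by rewrite gt_eqF//; case/andP: hmu.
have nz := qfac_neq0 q_lt1_neq.
rewrite /Phi /gfac /qbinom /weight /= !leq_addr !addKn !qpoch_qE.
have -> : (b.1 + i + (b.2 + j) - (b.1 + b.2) = i + j)%N.
  by rewrite addnACA addKn.
rewrite -qpoch_qdiff ?invr_eq0// invrK [lam^-1 * mu]mulrC addnACA.
have pz : qpoch q mu (b.1 + b.2 + (i + j)) != 0 by exact: qpoch_neq0.
rewrite !exprD !exprMn !exprVn.
by field; rewrite ?nz ?pz ?lam0 ?mu0 ?expf_neq0.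
Qed.

Lemma Phi_gfacC (lam mu : R) (b : nat * nat) i j : 0 < lam < 1 -> 0 < mu < 1 ->
  (Phi q b (b.1 + i, b.2 + j)%N lam mu)%:C%C
    * (gfac q (b.1 + i, b.2 + j)%N mu)%:C%C =
  (q ^+ (i * b.2))%:C%C * (gfac q b lam)%:C%C
    * (qdiff q%:C%C mu^-1%:C%C lam^-1%:C%C (i + j) / (qfac q%:C%C i * qfac q%:C%C j)).
Proof.
move=> hlam hmu; have := Phi_gfac b i j hlam hmu.
move: (Phi _ _ _ _ _) (gfac _ (_, _) mu) (gfac _ b lam) => P G G' PG.
by rewrite -rmorphM PG !rmorphM fmorphV rmorphM /= qdiffC !qfacC.
Qed.

End QFactors.

(** * The exchange and auxiliary relations in the operator algebra *)

Section ZamolodchikovFaddeev.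
Variables (R : realType) (q : R).
Hypothesis hq : 0 < q < 1.
Local Notation C := R[i].
Local Notation z := (@bp_op R).
Local Notation B := (bm_op q).
Local Notation k := (k_op q).

Definition ratio_coef (mu : R) j := qpoch q mu j / qpoch q q j * mu^-1 ^+ j.

Definition ratio_op mu : fock_op R := series_op (ratio_coef mu).

Definition X_op a mu : fock_op R :=
  (gfac q a mu)%:C%C *: (ratio_op mu * k ^+ a.2 * B ^+ a.1).

Lemma X_opE a mu : Xop q a mu = fock_fun (X_op a mu).
Proof.
rewrite /Xop /Zop -[iter _ (kop q)](fock_expE k).
by rewrite -[iter _ (bminus q)](fock_expE B).
Qed.

(** With f(z) = (z)_oo / (z/mu)_oo this is (1 - z) f(q z) = (1 - z/mu) f(z), verified through the
    recursion of the q-binomial coefficients. *)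
Lemma k_ratio mu : mu != 0 ->
  (1 - z) * (k * ratio_op mu) = (1 - (mu^-1)%:C%C *: z) * (ratio_op mu * k).
Proof.
move=> mu0; rewrite k_series !mulrA; congr (_ * k).
rewrite -{1}[z]scale1r -(rmorph1 (real_complex R)) !affine_series.
congr series_op; apply/funext => -[|j]; first by rewrite mulr1.
rewrite /ratio_coef !(qpoch_qE q) qfacS {1 3}/qpoch !big_ord_recr /= -/(qpoch q mu j).
have nz := qfac_neq0 (q_lt1_neq hq) j; have := q_lt1_neq hq j; rewrite !exprS => nzS.
by field; rewrite nz nzS mu0.
Qed.

Lemma ratio_inv mu : exists d,
  series_op d * ratio_op mu = 1 /\ ratio_op mu * series_op d = 1.
Proof.
by apply: series_op_inv; rewrite /ratio_coef /qpoch !big_ord0 expr0 divr1 mulr1.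
Qed.

Lemma bmX_kX i b : B ^+ i * k ^+ b = (q ^+ (i * b))%:C%C *: (k ^+ b * B ^+ i).
Proof.
have BkX : B * k ^+ b = (q ^+ b)%:C%C *: (k ^+ b * B).
  elim: b => [|b IHb]; first by rewrite expr0 mulr1 mul1r scale1r.
  rewrite exprSr mulrA IHb -scalerAl -[_ * B * k]mulrA bm_k -scalerAr.
  by rewrite scalerA mulrA [in RHS]exprSr rmorphM.
elim: i => [|i IHi]; first by rewrite expr0 mulr1 mul1r scale1r.
rewrite [in LHS]exprSr -[LHS]mulrA BkX -scalerAr [B ^+ i * _]mulrA IHi -scalerAl.
rewrite scalerA -[_ * B ^+ i * B]mulrA -exprSr.
by rewrite -rmorphM mulSn exprD.
Qed.

Lemma fock_inverse1z : exists Y : fock_op R, (1 - z) * Y = 1 /\ Y * (1 - z) = 1.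
Proof.
pose c j : R := if j is j'.+1 then - (j' == 0%N)%:R else 1.
have [//|d [dK Kd]] := @series_op_inv R c.
exists (series_op d); suff -> : 1 - z = series_op c by [].
rewrite -[1 - z]mulr1 -[X in _ * X]series_op1 -[z]scale1r -(rmorph1 (real_complex R)).
rewrite affine_series; congr series_op; apply/funext => -[|j] //.
by rewrite sub0r mul1r.
Qed.

(** The exchange relation at w = 1/lam and v = 1/mu, multiplied on the right by the word of [b]. The
    pair (i, j) is the amount transferred from [a] to [b]. *)
Lemma ZF_operators lam mu a b : 0 < lam < 1 -> 0 < mu < 1 ->
  X_op a mu * X_op b lam = \sum_(i < a.1.+1) \sum_(j < a.2.+1)
    (Phi q b (b.1 + i, b.2 + j)%N lam mu)%:C%C *:
      (X_op (a.1 - i, a.2 - j)%N lam * X_op (b.1 + i, b.2 + j)%N mu).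
Proof.
move=> hlam hmu.
have lam0 : lam != 0 by rewrite gt_eqF//; case/andP: hlam.
have mu0 : mu != 0 by rewrite gt_eqF//; case/andP: hmu.
have [f' [fK Kf]] := ratio_inv lam; have [g' [gK Kg]] := ratio_inv mu.
have [Y [YK KY]] := fock_inverse1z.
have := exchange_relation (qC_neq0 hq) (qC_not_root1 hq) (@bp_op_lreg R) (bp_bm q)
  (k_bp q) (bm_k q) YK KY a.1 a.2 fK Kf (bp_series _) (k_ratio lam0)
  gK Kg (bp_series _) (k_ratio mu0) (series_opC _ _).
move=> /(congr1 (fun e => (gfac q b lam)%:C%C *: (e * (k ^+ b.2 * B ^+ b.1)))).
set f := ratio_op lam; set g := ratio_op mu => E.
transitivity ((gfac q b lam)%:C%C *: (qdiff q%:C%C mu^-1%:C%C 1 (a.1 + a.2) *: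
  (g * qmonom q%:C%C k B a.1 a.2 * f) * (k ^+ b.2 * B ^+ b.1))).
  rewrite /X_op -/f -/g (gfacC q a mu0) /qmonom.
  rewrite -!scalerAr -!scalerAl !scalerA.
  by congr (_ *: _); rewrite !mulrA.
apply: (etrans E); rewrite mulr_suml scaler_sumr; apply: eq_bigr => i _.
rewrite mulr_suml scaler_sumr; apply: eq_bigr => j _ /=.
have qx0 : (q ^+ (i * b.2))%:C%C != 0.
  by rewrite fmorph_eq0 expf_neq0// gt_eqF//; case/andP: hq.
(* Splitting off the word of [b] costs q^(-i b.2), which cancels the power of [q] supplied by
   [Phi]. *)
have kBE : k ^+ (b.2 + j) * B ^+ (b.1 + i) =
    (q ^+ (i * b.2))%:C%C^-1 *: (k ^+ j * B ^+ i * (k ^+ b.2 * B ^+ b.1)).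
  rewrite addnC [(b.1 + i)%N]addnC !exprD !mulrA -[k ^+ j * B ^+ i * _]mulrA.
  by rewrite bmX_kX -scalerAr -scalerAl scalerA mulVf// scale1r !mulrA.
rewrite /X_op -/f -/g /= (gfacC q (a.1 - i, a.2 - j)%N lam0) /=.
rewrite -[_ * k ^+ (b.2 + j) * _]mulrA kBE.
have := Phi_gfacC hq b i j hlam hmu.
set P := (Phi _ _ _ _ _)%:C%C; set G := (gfac _ _ mu)%:C%C => PG.
have -> : (a.1 - i + (a.2 - j) = a.1 + a.2 - (i + j))%N.
  have leia : (i <= a.1)%N by rewrite -ltnS.
  have leja : (j <= a.2)%N by rewrite -ltnS.
  by apply/eqP; rewrite -(eqn_add2r (i + j)) addnACA !subnK// leq_add.
rewrite /qmonom -!scalerAr -!scalerAl !scalerA.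
congr (_ *: _); last by rewrite !mulrA.
set Q := qdiff _ _ 1 _.
have nz := qfac_neq0 (qC_not_root1 hq).
by rewrite [P * _]mulrA PG; field; rewrite !nz qx0.
Qed.

Lemma gfac_neq0 a (mu : R) : 0 < mu < 1 -> gfac q a mu != 0.
Proof.
move=> hmu; rewrite !mulf_neq0 ?invr_eq0 ?mulf_neq0 ?qpoch_neq0//.
by rewrite expf_neq0// gt_eqF//; case/andP: hmu.
Qed.

Lemma auxiliary_operators lam mu b c d : 0 < mu < 1 ->
    series_op d * ratio_op lam = 1 ->
  X_op b mu * series_op d * X_op c lam =
  (q ^+ (b.1 * c.2) * (gfac q b mu * gfac q c lam / gfac q (b + c) mu))%:C%C
    *: X_op (b + c) mu.
Proof.
move=> hmu dK; rewrite /X_op scalerA -rmorphM -[_ * (_ / _) * _]mulrA.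
rewrite divfK ?gfac_neq0//.
rewrite !rmorphM /= -!scalerAl -!scalerAr !scalerA.
rewrite -!mulrA [series_op d * _]mulrA dK mul1r [B ^+ b.1 * _]mulrA bmX_kX.
rewrite -!scalerAl -!scalerAr scalerA !exprD !mulrA; congr (_ *: _).
by ring.
Qed.

(** The q-binomials in [Phi] force [p.2] to dominate [b] componentwise, and conservation of the
    total then determines [p.1] from the excess [e]. *)
Lemma Smx_support lam mu (a b : nat * nat) p : Smx q lam mu p.1 p.2 b a != 0 ->
  exists2 e : nat * nat, (e.1 <= a.1)%N && (e.2 <= a.2)%N &
    p = ((a.1 - e.1, a.2 - e.2)%N, (b.1 + e.1, b.2 + e.2)%N).
Proof.
case: p a b => [[c1 c2] [d1 d2]] [a1 a2] [b1 b2]; rewrite /Smx /Phi /qbinom /=.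
case: (_ + _ =P _) => [[E1 E2]|_]; last by rewrite eqxx.
case: leqP => [le1|_]; last by rewrite mulr0 mul0r eqxx.
case: leqP => [le2|_]; last by rewrite mulr0 eqxx.
have F1 : (c1 + (d1 - b1) = a1)%N by apply: (@addnI b1); rewrite addnCA subnKC.
have F2 : (c2 + (d2 - b2) = a2)%N by apply: (@addnI b2); rewrite addnCA subnKC.
move=> _; exists (d1 - b1, d2 - b2)%N; rewrite /= -?F1 -?F2 ?leq_addl//.
by rewrite !addnK !subnKC.
Qed.

Lemma fsum_Smx (M : lmodType C) lam mu (a b : nat * nat)
    (X : (nat * nat) * (nat * nat) -> M) :
  \sum_(p \in [set: (nat * nat) * (nat * nat)]%classic)
     (Smx q lam mu p.1 p.2 b a)%:C%C *: X p =
  \sum_(i < a.1.+1) \sum_(j < a.2.+1)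
    (Phi q b (b.1 + i, b.2 + j)%N lam mu)%:C%C
      *: X ((a.1 - i, a.2 - j)%N, (b.1 + i, b.2 + j)%N).
Proof.
pose F i j := ((a.1 - i, a.2 - j)%N, (b.1 + i, b.2 + j)%N).
rewrite (fsbigE (allpairs F (iota 0 a.1.+1) (iota 0 a.2.+1))) //; first last.
- move=> p _ /negP pNr.
  have [-> |/Smx_support[e /andP[e1 e2] pE]] :=
    eqVneq (Smx q lam mu p.1 p.2 b a) 0.
    by rewrite scale0r.
  by case: pNr; rewrite pE; apply/allpairsP; exists e; rewrite !mem_iota !ltnS.
(* Injectivity is read from the second pair, where (i, j) is added; the truncated subtraction in the
   first pair is ignored. *)
- rewrite allpairs_uniq ?iota_uniq// => -[i j] [i' j'] _ _ [_ _].
  by move=> /addnI -> /addnI ->.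
rewrite big_mkcond big_allpairs_dep.
rewrite -[iota 0 a.1.+1]/(index_iota 0 a.1.+1) big_mkord; apply: eq_bigr => i _.
rewrite -[iota 0 a.2.+1]/(index_iota 0 a.2.+1) big_mkord; apply: eq_bigr => j _.
rewrite in_setT /Smx /=; case: (_ + _ =P _) => //.
(* What remains is the case where theta is false; it is impossible, since the bounds on i and j make
   the subtractions exact. *)
have leia : (i <= a.1)%N by rewrite -ltnS.
have leja : (j <= a.2)%N by rewrite -ltnS.
move: (nat_of_ord i) (nat_of_ord j) leia leja => i' j' leia leja; case.
rewrite -[b + a]/(b.1 + a.1, b.2 + a.2)%N.
rewrite -[RHS]/(a.1 - i' + (b.1 + i'), a.2 - j' + (b.2 + j'))%N.
by congr (_, _); rewrite addnCA subnK.
Qed.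

End ZamolodchikovFaddeev.

(** * Transfer from the operator algebra to maps on the completed Fock space *)

Theorem theorem8 (R : realType) (q : R) (hq : 0 < q < 1)
    (lam mu : R) (hlam : 0 < lam < 1) (hmu : 0 < mu < 1) :
  (forall alpha beta : nat * nat,
     Xop q alpha mu \o Xop q beta lam =
     \sum_(p \in [set: (nat * nat) * (nat * nat)]%classic)
       (Smx q lam mu p.1 p.2 beta alpha)%:C%C
         *: (Xop q p.1 lam \o Xop q p.2 mu))
  /\
  (exists X0inv : {linear Fock R -> Fock R},
     [/\ cancel (Xop q 0 lam) X0inv,
         cancel X0inv (Xop q 0 lam)
       & forall beta gamma : nat * nat,
           Xop q beta mu \o X0inv \o Xop q gamma lam =
           (q ^+ (beta.1 * gamma.2)%N
            * (gfac q beta mu * gfac q gamma lam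
               / gfac q (beta + gamma) mu))%:C%C
             *: Xop q (beta + gamma) mu]).
Proof.
split=> [a b|].
  rewrite (fsum_Smx q lam mu a b (fun p => Xop q p.1 lam \o Xop q p.2 mu)).
  rewrite !X_opE -fock_mulE (ZF_operators hq a b hlam hmu) fock_sumE.
  apply: eq_bigr => i _; rewrite fock_sumE; apply: eq_bigr => j _.
  by rewrite !X_opE.
have [d [dK Kd]] := ratio_inv q lam.
(* Since g_0 = 1 and the word is empty, the reciprocal power series serves as the inverse of X_0. *)
have X0E : X_op q 0 lam = ratio_op q lam.
  rewrite /X_op /gfac /qpoch !big_ord0 /= !expr0 !mulr1 invr1 mulr1.
  by rewrite rmorph1 scale1r.
exists (fock_fun (series_op d)); split=> [v|v|b c].
- by rewrite X_opE X0E -[LHS]/((series_op d * ratio_op q lam) v) dK.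
- by rewrite X_opE X0E -[LHS]/((ratio_op q lam * series_op d) v) Kd.
rewrite !X_opE -[LHS]/(fock_fun (X_op q b mu * series_op d * X_op q c lam)).
by rewrite (auxiliary_operators hq _ _ hmu dK).
Qed.
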